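(* Let $\mathcal C\subseteq\mathcal P_{p_1+p_2}$ be closed under diagonal enlargement, let $\mathcal D\subseteq\mathcal D^{\max}$ and let $\hat{\boldsymbol P}\colon\mathcal D\to\mathcal P_n$ be a map. Then $\hat{\boldsymbol P}$ preserves conservativeness on $\mathcal C$ if and only if $$\begin{pmatrix}K_1&K_2\end{pmatrix}\begin{pmatrix}\hat P_1&\hat P_{12}\\ \hat P_{12}^\top&\hat P_2\end{pmatrix}\begin{pmatrix}K_1^\top\\ K_2^\top\end{pmatrix}\preceq\hat{\boldsymbol P}(K_1,K_2,\hat x_1,\hat x_2,\hat P_1,\hat P_2)$$ for all $(K_1,K_2,\hat x_1,\hat x_2,\hat P_1,\hat P_2)\in\mathcal D$ and all $\hat P_{12}\in\mathbb R^{p_1\times p_2}$ with $\begin{pmatrix}\hat P_1&\hat P_{12}\\ \hat P_{12}^\top&\hat P_2\end{pmatrix}\in\mathcal C$.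
   Context: $n,p_1,p_2$ are positive integers with $p_1,p_2\le n$, and $H_1\in\mathbb R^{p_1\times n}$, $H_2\in\mathbb R^{p_2\times n}$ are fixed matrices of full row rank. $\mathcal P_m$ is the set of real symmetric positive semi-definite $m\times m$ matrices; $\preceq$ is the Löwner order. $\mathcal D^{\max}:=\{(K_1,K_2,\hat x_1,\hat x_2,\hat P_1,\hat P_2)\in\mathbb R^{n\times p_1}\times\mathbb R^{n\times p_2}\times\mathbb R^{p_1}\times\mathbb R^{p_2}\times\mathcal P_{p_1}\times\mathcal P_{p_2} : K_1H_1+K_2H_2=I\}$. A set $\mathcal C\subseteq\mathcal P_{p_1+p_2}$ is closed under diagonal enlargement if $\begin{pmatrix}P_1&P_{12}\\ P_{12}^\top&P_2\end{pmatrix}\in\mathcal C$, $P_1\preceq\hat P_1$ and $P_2\preceq\hat P_2$ imply $\begin{pmatrix}\hat P_1&P_{12}\\ P_{12}^\top&\hat P_2\end{pmatrix}\in\mathcal C$. $\hat{\boldsymbol P}$ preserves conservativeness on $\mathcal C$ if for all $(K_1,K_2,\hat x_1,\hat x_2,\hat P_1,\hat P_2)\in\mathcal D$ and all $\begin{pmatrix}P_1&P_{12}\\ P_{12}^\top&P_2\end{pmatrix}\in\mathcal C$ (with $P_i$ of size $p_i\times p_i$): if $P_1\preceq\hat P_1$ and $P_2\preceq\hat P_2$, then $$\begin{pmatrix}K_1&K_2\end{pmatrix}\begin{pmatrix}P_1&P_{12}\\ P_{12}^\top&P_2\end{pmatrix}\begin{pmatrix}K_1^\top\\ K_2^\top\end{pmatrix}\preceq\hat{\boldsymbol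 P}(K_1,K_2,\hat x_1,\hat x_2,\hat P_1,\hat P_2).$$ *)

(* Defs.v *)
From mathcomp Require Import all_boot all_order all_algebra.
From mathcomp Require Import all_classical reals.

Set Implicit Arguments.
Unset Strict Implicit.
Unset Printing Implicit Defensive.

Import Order.TTheory GRing.Theory Num.Theory.
Local Open Scope classical_set_scope.
Local Open Scope ring_scope.

Definition psdmx (R : realType) (m : nat) : set 'M[R]_m :=
  [set M | M \is symmetricmx /\ forall x : 'cV[R]_m, 0 <= (x^T *m M *m x) 0 0].
Arguments psdmx R m : clear implicits.

(* The Loewner order.  As B - A is required to be symmetric, B is symmetric
   as soon as A is. *)
Definition loewner_le (R : realType) (m : nat) (A B : 'M[R]_m) : Prop :=
  psdmx R m (B - A).

Notation "A ⪯ B" := (loewner_le A B) (at level 70, no associativity).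

(* Tuples (K1, K2, x1, x2, P1, P2). *)
Definition fusion_input (R : realType) (n p1 p2 : nat) : Type :=
  ('M[R]_(n, p1) * 'M[R]_(n, p2) * 'cV[R]_p1 * 'cV[R]_p2
    * 'M[R]_p1 * 'M[R]_p2)%type.

Definition Dmax (R : realType) (n p1 p2 : nat)
    (H1 : 'M[R]_(p1, n)) (H2 : 'M[R]_(p2, n)) : set (fusion_input R n p1 p2) :=
  [set d | let: (K1, K2, _, _, P1, P2) := d in
    [/\ psdmx R p1 P1, psdmx R p2 P2 & K1 *m H1 + K2 *m H2 = 1%:M]].

Definition closed_diag_enlargement (R : realType) (p1 p2 : nat)
    (C : set 'M[R]_(p1 + p2)) : Prop :=
  forall (P1 Ph1 : 'M[R]_p1) (P2 Ph2 : 'M[R]_p2) (P12 : 'M[R]_(p1, p2)),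
    C (block_mx P1 P12 P12^T P2) -> P1 ⪯ Ph1 -> P2 ⪯ Ph2 ->
    C (block_mx Ph1 P12 P12^T Ph2).

(* Only the values of Phat on D matter. *)
Definition preserves_conservativeness (R : realType) (n p1 p2 : nat)
    (C : set 'M[R]_(p1 + p2)) (D : set (fusion_input R n p1 p2))
    (Phat : fusion_input R n p1 p2 -> 'M[R]_n) : Prop :=
  forall (K1 : 'M[R]_(n, p1)) (K2 : 'M[R]_(n, p2))
         (x1 : 'cV[R]_p1) (x2 : 'cV[R]_p2) (Ph1 : 'M[R]_p1) (Ph2 : 'M[R]_p2),
    D (K1, K2, x1, x2, Ph1, Ph2) ->
    forall (P1 : 'M[R]_p1) (P12 : 'M[R]_(p1, p2)) (P2 : 'M[R]_p2),
      C (block_mx P1 P12 P12^T P2) -> P1 ⪯ Ph1 -> P2 ⪯ Ph2 ->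
      row_mx K1 K2 *m block_mx P1 P12 P12^T P2 *m col_mx K1^T K2^T
        ⪯ Phat (K1, K2, x1, x2, Ph1, Ph2).

(* Main.v *)
Require Import Defs.
From mathcomp Require Import all_boot all_order all_algebra.
From mathcomp Require Import all_classical reals.

Set Implicit Arguments.
Unset Strict Implicit.
Unset Printing Implicit Defensive.

Import Order.TTheory GRing.Theory Num.Theory.
Local Open Scope classical_set_scope.
Local Open Scope ring_scope.

(** Since the estimates may be taken equal to the true covariances, the
    inequality with estimated diagonal blocks is a special case of
    conservativeness, by reflexivity of the Loewner order.

    Conversely, write [M] for the joint covariance with true diagonal blocks
    [P1], [P2], and [Mh] for the one with the estimated blocks [Ph1], [Ph2] and
    the same off-diagonal block.  Then [Mh - M] is the block-diagonal matrix
    with positive semi-definite blocks [Ph1 - P1] and [Ph2 - P2], so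
    conjugating by [row_mx K1 K2] increases the fused covariance
    ([fused_cov_le]).  Closure under diagonal enlargement puts [Mh] in [C],
    so the fused covariance of [Mh] lies below the bound, and transitivity
    concludes. *)

Lemma symmetricmxP (R : realType) (m : nat) (A : 'M[R]_m) :
  reflect (A = A^T) (A \is symmetricmx).
Proof.
by apply: (iffP (is_hermitianmxP _ _ _)); rewrite expr0 scale1r map_mx_id.
Qed.

Lemma psdmx0 (R : realType) (m : nat) : psdmx R m 0.
Proof.
by split=> [|x]; [apply/symmetricmxP; rewrite trmx0 | rewrite mulmx0 mul0mx mxE].
Qed.

Lemma psdmxD (R : realType) (m : nat) (A B : 'M[R]_m) :
  psdmx R m A -> psdmx R m B -> psdmx R m (A + B).
Proof.
move=> [/symmetricmxP symA A_ge0] [/symmetricmxP symB B_ge0]; split=> [|x].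
  by apply/symmetricmxP; rewrite linearD /= -symA -symB.
by rewrite mulmxDr mulmxDl mxE addr_ge0.
Qed.

(** The quadratic form of [K *m A *m K^T] at [x] is that of [A] at
    [K^T *m x]. *)
Lemma psdmx_congr (R : realType) (m n : nat) (K : 'M[R]_(n, m)) (A : 'M[R]_m) :
  psdmx R m A -> psdmx R n (K *m A *m K^T).
Proof.
move=> [/symmetricmxP symA A_ge0]; split=> [|x].
  by apply/symmetricmxP; rewrite !trmx_mul trmxK -symA mulmxA.
by have := A_ge0 (K^T *m x); rewrite trmx_mul trmxK !mulmxA.
Qed.

Lemma loewner_le_refl (R : realType) (m : nat) (A : 'M[R]_m) : A ⪯ A.
Proof. by rewrite /loewner_le subrr; exact: psdmx0. Qed.

Lemma loewner_le_trans (R : realType) (m : nat) (A B C : 'M[R]_m) :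
  A ⪯ B -> B ⪯ C -> A ⪯ C.
Proof.
by move=> leAB leBC; rewrite /loewner_le -(subrKA B); exact: psdmxD.
Qed.

(** The off-diagonal terms cancel in the difference, which is therefore
    [K1 (Ph1 - P1) K1^T + K2 (Ph2 - P2) K2^T]. *)
Lemma fused_cov_le (R : realType) (n p1 p2 : nat)
    (K1 : 'M[R]_(n, p1)) (K2 : 'M[R]_(n, p2)) (P1 Ph1 : 'M[R]_p1)
    (P2 Ph2 : 'M[R]_p2) (P12 : 'M[R]_(p1, p2)) (P21 : 'M[R]_(p2, p1)) :
  P1 ⪯ Ph1 -> P2 ⪯ Ph2 ->
  row_mx K1 K2 *m block_mx P1 P12 P21 P2 *m col_mx K1^T K2^T
    ⪯ row_mx K1 K2 *m block_mx Ph1 P12 P21 Ph2 *m col_mx K1^T K2^T.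
Proof.
move=> le1 le2; rewrite /loewner_le -mulmxBl -mulmxBr opp_block_mx add_block_mx.
rewrite !subrr mul_row_block !mulmx0 addr0 add0r mul_row_col.
by apply: psdmxD; exact: psdmx_congr.
Qed.

Theorem proposition2 (R : realType) (n p1 p2 : nat)
    (n_gt0 : (0 < n)%N) (p1_gt0 : (0 < p1)%N) (p2_gt0 : (0 < p2)%N)
    (le_p1n : (p1 <= n)%N) (le_p2n : (p2 <= n)%N)
    (H1 : 'M[R]_(p1, n)) (H2 : 'M[R]_(p2, n))
    (H1_full : row_free H1) (H2_full : row_free H2)
    (C : set 'M[R]_(p1 + p2)) (C_psd : C `<=` psdmx R (p1 + p2))
    (C_closed : closed_diag_enlargement C)
    (D : set (fusion_input R n p1 p2)) (D_sub : D `<=` Dmax H1 H2)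
    (Phat : {fun D >-> psdmx R n}) :
  preserves_conservativeness C D Phat <->
  (forall (K1 : 'M[R]_(n, p1)) (K2 : 'M[R]_(n, p2))
          (x1 : 'cV[R]_p1) (x2 : 'cV[R]_p2) (Ph1 : 'M[R]_p1) (Ph2 : 'M[R]_p2),
     D (K1, K2, x1, x2, Ph1, Ph2) ->
     forall Ph12 : 'M[R]_(p1, p2),
       C (block_mx Ph1 Ph12 Ph12^T Ph2) ->
       row_mx K1 K2 *m block_mx Ph1 Ph12 Ph12^T Ph2 *m col_mx K1^T K2^T
         ⪯ Phat (K1, K2, x1, x2, Ph1, Ph2)).
Proof.
split=> [consP K1 K2 x1 x2 Ph1 Ph2 Dd Ph12 CPh | boundP].
  by apply: consP => //; exact: loewner_le_refl.
move=> K1 K2 x1 x2 Ph1 Ph2 Dd P1 P12 P2 CP le1 le2.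
apply: loewner_le_trans (fused_cov_le K1 K2 P12 P12^T le1 le2) _.
by apply: boundP => //; exact: C_closed CP le1 le2.
Qed.
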